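(* Let $r\geq 2$ be an integer and let $n$ be a positive integer. Every $r$-coloring of the edges of $K_n$ contains a monochromatic path-matching of order at least $3\left\lfloor\frac{n}{r+2}\right\rfloor$.
   Context: A path-matching is a vertex-disjoint union of paths, each with at least 2 vertices; its order is the number of vertices it spans (the empty union is allowed and has order $0$). An $r$-coloring of $K_n$ is an assignment of a color from $[r]=\{1,\dots,r\}$ to each edge of the complete graph $K_n$ (not necessarily proper, and not every color need be used). A path-matching is monochromatic if it is a subgraph of $K_n$ all of whose edges have the same color. *)

(* Defs.v *)
From mathcomp Require Import all_boot.

Set Implicit Arguments.
Unset Strict Implicit.
Unset Printing Implicit Defensive.

(* Edges of the complete graph K_n on the vertex set 'I_n. An r-coloring of
   K_n is an arbitrary function edge n -> 'I_r. *)
Definition edge (n : nat) := {e : {set 'I_n} | #|e| == 2}.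

Definition edge_colored (n r : nat) (c : edge n -> 'I_r) (a : 'I_r) : rel 'I_n :=
  fun x y => [exists e : edge n, (val e == [set x; y]) && (c e == a)].

(* A vertex-disjoint union of paths is the list M of its components, each given
   by its vertices in the order of traversal. Uniqueness of the concatenated
   list says both that each component is a path (no repeated vertex) and that
   distinct components are disjoint; consecutive vertices of a component are
   then distinct, hence adjacent in K_n. *)
Definition path_matching (n : nat) (M : seq (seq 'I_n)) : bool :=
  uniq (flatten M) && all (fun p => 2 <= size p) M.

Definition pm_order (n : nat) (M : seq (seq 'I_n)) : nat :=
  #|[set x in flatten M]|.

Definition monochromatic (n r : nat) (c : edge n -> 'I_r)
    (M : seq (seq 'I_n)) : Prop :=
  exists a : 'I_r, all (sorted (edge_colored c a)) M.

(* Main.v *)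
Require Import Defs.
From mathcomp Require Import all_boot.
From mathcomp Require Import zify.

Set Implicit Arguments.
Unset Strict Implicit.
Unset Printing Implicit Defensive.

(* By a min-max theorem for packings by the stars K_{1,1} and K_{1,2}, proved
   with augmenting paths, a graph has a path-matching and a set X, disjoint from
   its neighborhood N(X), such that the path-matching has order at least
   |V| - |X| + 2|N(X)|. Apply this to each color i and suppose that all the
   orders are below 3k, where k = n / (r + 2). Put t_i = k - |N(X_i)|. Deleting
   all the N(X_i) leaves at least 2k + \sum_i t_i vertices, and every edge of
   color i between them avoids X_i, so their complete graph is covered by the r
   cliques B_i, the complements of X_i and N(X_i), with |B_i| < 3 t_i. Extend
   the clique with the largest t_i to a set C of size 3 t_i - 1; the other
   cliques are too small to cover all the pairs between C and its complement. *)

(** * Covering a complete graph by small cliques *)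

Lemma card_bigcup_leq (I T : finType) (P : pred I) (F : I -> {set T}) :
  #|\bigcup_(i | P i) F i| <= \sum_(i | P i) #|F i|.
Proof.
elim/big_rec2: _ => [|i m A _ IH]; first by rewrite cards0.
by apply: leq_trans (leq_card_setU _ _) _; rewrite leq_add2l.
Qed.

Lemma exists_intermediate_set (T : finType) (A W : {set T}) m :
  A \subset W -> #|A| <= m <= #|W| ->
  exists C : {set T}, [/\ A \subset C, C \subset W & #|C| = m].
Proof.
move=> sAW; elim: m => [|m IH] /andP[leAm lemW].
  exists A; split=> //; lia.
have [eqA|neqA] := eqVneq #|A| m.+1; first by exists A.
have [|C [sAC sCW cardC]] := IH; first by lia.
have /set0Pn[x] : W :\: C != set0.
  by rewrite -card_gt0 cardsD (setIidPr sCW); lia.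
rewrite inE => /andP[xNC xW].
exists (x |: C); split.
- exact: subset_trans sAC (subsetU1 _ _).
- by rewrite subUset sub1set xW.
- by rewrite cardsU1 xNC cardC.
Qed.

(** Otherwise, split [W] into a set [C] of size [3 * t i0 - 1] containing the part of [B i0] in [W],
    and its rest [U]. The other cliques cover all pairs between [C] and [U], each at most
    [3 / 4 * #|C| * t i] of them, yet [U] has more than the sum of these [t i] elements. *)
Lemma clique_cover_card (V I : finType) (W : {set V}) (B : I -> {set V})
    (t : I -> nat) (i0 : I) :
  (forall i, t i <= t i0) ->
  (forall i, #|B i| < 3 * t i) ->
  {in W &, forall u v, u != v -> exists2 i, u \in B i & v \in B i} ->
  #|W| < 2 * t i0 + \sum_i t i.
Proof.
move=> tmax cardB coverB; rewrite ltnNge; apply/negP => cardW.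
have sumD : \sum_i t i = t i0 + \sum_(i | i != i0) t i by rewrite (bigD1 i0).
have B0 := cardB i0.
(* The size [3 * t i0 - 1] is the largest that [B i0] may have; it is at most [#|W|] because [t i0]
   also occurs in the sum. *)
have [||C [sBC sCW cardC]] :=
    @exists_intermediate_set _ (B i0 :&: W) W (3 * t i0).-1.
- exact: subsetIr.
- have := subset_leq_card (subsetIl (B i0) W); lia.
set U := W :\: C.
have cardU : 1 + \sum_(i | i != i0) t i <= #|U|.
  by rewrite cardsD (setIidPr sCW) cardC; lia.
have crossing : setX C U \subset
    \bigcup_(i | i != i0) setX (C :&: B i) (U :&: B i).
  apply/subsetP=> -[u v]; rewrite !inE /= => /and3P[uC vNC vW].
  have [|i uB vB] := coverB u v (subsetP sCW _ uC) vW.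
    by apply: contraNneq vNC => <-.
  apply/bigcupP; exists i; last by rewrite !inE uC uB vNC vW vB.
  apply: contraNneq vNC => eqi; apply: (subsetP sBC).
  by rewrite inE -eqi vB.
have := leq_trans (subset_leq_card crossing) (card_bigcup_leq _ _).
rewrite cardsX cardC => count.
(* By AM-GM the left side is at most the square of [#|B i|]. One factor is bounded through
   [t i <= t i0] by [3 * t i0 - 1], the size of [C], the other by [3 * t i]. *)
have bound i : i != i0 ->
    4 * #|setX (C :&: B i) (U :&: B i)| <= (3 * t i0).-1 * (3 * t i).
  move=> _; rewrite cardsX.
  have disj : #|C :&: B i| + #|U :&: B i| <= #|B i|.
    rewrite -(cardsID C (B i)) setIC leq_add2l; apply: subset_leq_card.
    by apply/subsetP=> x; rewrite !inE => /andP[/andP[-> _] ->].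
  rewrite (leq_trans (nat_AGM2 _ _)) // expnS expn1.
  have := cardB i; have := tmax i => le_t lt_B.
  apply: leq_mul; lia.
suff : 4 * ((3 * t i0).-1 * #|U|) <= (3 * t i0).-1 * (3 * \sum_(i | i != i0) t i).
  by rewrite mulnCA leq_pmul2l; lia.
apply: leq_trans (leq_mul (leqnn 4) count) _.
by rewrite !big_distrr /=; exact: leq_sum.
Qed.

(** * Star packings and their local modifications *)

Section StarPacking.

Variables (V : finType) (e : rel V).
Hypotheses (e_sym : symmetric e) (e_irr : irreflexive e).

Implicit Types (f g : {ffun V -> option V}) (x y w : V).

(* A vertex-disjoint family of stars is encoded by the partial map [f] sending
   each leaf to its center; [None] marks the centers and the uncovered vertices. *)
Definition leaves f w : {set V} := [set x | f x == Some w].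

(** Requiring [f w == None] keeps centers from being leaves, so the stars are disjoint. In a single
    edge either end may serve as the center. *)
Definition star_packing f : bool :=
  [forall x, forall w, (f x == Some w) ==> e x w && (f w == None)]
  && [forall w, #|leaves f w| <= 2].

Definition covered f : {set V} :=
  [set x | (f x != None) || (leaves f x != set0)].

Definition update f x (o : option V) : {ffun V -> option V} :=
  [ffun z => if z == x then o else f z].

Lemma star_packingP f :
  reflect ((forall x w, f x = Some w -> e x w /\ f w = None)
           /\ forall w, #|leaves f w| <= 2)
          (star_packing f).
Proof.
apply: (iffP andP) => -[edges deg]; split.
- move=> x w /eqP fx.
  by have /andP[? /eqP] := implyP (forallP (forallP edges x) w) fx.
- exact/forallP.
- apply/forallP=> x; apply/forallP=> w; apply/implyP=> /eqP /edges[-> ->].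
  by rewrite eqxx.
- exact/forallP.
Qed.

Lemma uncoveredP f x :
  reflect (f x = None /\ forall y, f y <> Some x) (x \notin covered f).
Proof.
rewrite inE negb_or !negbK; apply: (iffP andP) => -[/eqP fx lx]; split=> //.
  by move=> y fy; move/eqP/setP/(_ y): lx; rewrite !inE fy eqxx.
by apply/eqP/setP=> y; rewrite !inE; apply/eqP/lx.
Qed.

Lemma covered_leaf f x w : f x = Some w -> x \in covered f.
Proof. by rewrite inE => ->. Qed.

Lemma covered_center f x w : f x = Some w -> w \in covered f.
Proof.
by move=> fx; rewrite inE orbC; apply/orP; left; apply/set0Pn; exists x;
  rewrite inE fx.
Qed.

Lemma update_same f x o : update f x o x = o.
Proof. by rewrite ffunE eqxx. Qed.

Lemma update_other f x o z : z != x -> update f x o z = f z.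
Proof. by rewrite ffunE => /negPf->. Qed.

Lemma add_leaf f x w :
  star_packing f -> x \notin covered f -> e x w -> f w = None ->
  #|leaves f w| < 2 ->
  star_packing (update f x (Some w))
  /\ x |: covered f \subset covered (update f x (Some w)).
Proof.
move=> /star_packingP[edges deg] /uncoveredP[fx lx] exw fw deg_w.
have neq_wx : w != x by apply: contraTneq exw => ->; rewrite e_irr.
split.
  apply/star_packingP; split=> [y v|v].
    have [->|neq_yx] := eqVneq y x.
      by rewrite update_same => -[<-]; rewrite update_other.
    rewrite update_other // => fy; rewrite update_other; first exact: edges.
    by apply/eqP=> eq_vx; apply: (lx y); rewrite fy eq_vx.
  have [->|neq_vw] := eqVneq v w.
    apply: leq_trans (_ : #|x |: leaves f w| <= 2).
      apply/subset_leq_card/subsetP=> y; rewrite !inE ffunE.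
      by case: (y == x).
    by rewrite (leq_trans (leq_card_setU _ _)) // cards1.
  apply: leq_trans (deg v); apply/subset_leq_card/subsetP=> y.
  rewrite !inE ffunE; case: (y == x) => //.
  by case/eqP=> eq_vw; rewrite eq_vw eqxx in neq_vw.
apply/subsetP=> y /setU1P[->|].
  by apply: covered_leaf (w) _; rewrite update_same.
apply: contraTT => /uncoveredP[gy ly]; apply/uncoveredP; split.
  by move: gy; rewrite ffunE; case: ifP.
move=> z fz; apply: (ly z); rewrite update_other //.
by apply/eqP=> eq_zx; rewrite eq_zx fx in fz.
Qed.

(** The center [b] keeps its other leaf, so at most [w] becomes uncovered, and [w] is then free to
    start a new star. *)
Lemma free_leaf f w b :
  star_packing f -> f w = Some b -> 1 < #|leaves f b| ->
  [/\ star_packing (update f w None),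
      covered f \subset w |: covered (update f w None)
    & leaves (update f w None) w = set0].
Proof.
move=> /star_packingP[edges deg] fw deg_b.
have lw y : f y <> Some w by move=> /edges[_]; rewrite fw.
split.
- apply/star_packingP; split=> [y v|v].
    have [->|neq_yw] := eqVneq y w; first by rewrite update_same.
    rewrite update_other // => /[dup] /edges[eyv fv] fy; split=> //.
    by rewrite ffunE fv if_same.
  apply: leq_trans (deg v); apply/subset_leq_card/subsetP=> y.
  by rewrite !inE ffunE; case: (y == w).
- apply/subsetP=> y; rewrite !inE; case: (eqVneq y w) => //= neq_yw.
  rewrite update_other //; case/orP=> [->//|/set0Pn[z]].
  rewrite inE => /eqP fz; apply/orP; right; apply/set0Pn.
  have [eq_zw|neq_zw] := eqVneq z w; last first.
    by exists z; rewrite inE update_other // fz.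
  have eq_yb : y = b by move: fz; rewrite eq_zw fw => -[].
  have : 0 < #|leaves f b :\ w|.
    by move: deg_b; rewrite (cardsD1 w) inE fw eqxx.
  rewrite card_gt0 => /set0Pn[u]; rewrite !inE => /andP[neq_uw fu].
  by exists u; rewrite inE update_other // eq_yb.
- apply/setP=> y; rewrite !inE ffunE; case: (y == w) => //.
  exact/eqP/lw.
Qed.

(** The star is the single edge from [w] to [b]; exchanging its ends makes [w] a center with room
    for a second leaf. *)
Lemma flip_star f w b :
  star_packing f -> f w = Some b -> #|leaves f b| <= 1 ->
  exists g, [/\ star_packing g, covered f \subset covered g,
                g w = None & #|leaves g w| <= 1].
Proof.
move=> /star_packingP[edges deg] fw deg_b.
have lw y : f y <> Some w by move=> /edges[_]; rewrite fw.
have [ewb fb] := edges _ _ fw.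
have neq_wb : w != b by apply: contraTneq ewb => ->; rewrite e_irr.
have lb y : f y = Some b -> y = w.
  move=> fy; have /cards1P[z lz] : #|leaves f b| == 1.
    by rewrite eqn_leq deg_b card_gt0; apply/set0Pn; exists w; rewrite inE fw.
  have : y \in leaves f b by rewrite inE fy.
  have : w \in leaves f b by rewrite inE fw.
  by rewrite lz !inE => /eqP-> /eqP.
pose g := update (update f w None) b (Some w).
have gw : g w = None by rewrite update_other // update_same.
have gb : g b = Some w by rewrite update_same.
have gE y : y != w -> y != b -> g y = f y.
  by move=> neq_yw neq_yb; rewrite !update_other.
have lgw : leaves g w \subset [set b].
  apply/subsetP=> y; rewrite !inE.
  have [->|neq_yw] := eqVneq y w; first by rewrite gw.
  by case: (eqVneq y b) => // neq_yb; rewrite gE // => /eqP /lw.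
exists g; split=> //.
- apply/star_packingP; split=> [y v|v].
    have [->|neq_yw] := eqVneq y w; first by rewrite gw.
    have [->|neq_yb] := eqVneq y b; first by rewrite gb e_sym => -[<-].
    rewrite gE // => /[dup] fy /edges[eyv fv]; split=> //.
    rewrite gE //; apply/eqP=> eq_v; rewrite eq_v in fy.
      exact: (lw y).
    by rewrite (lb y fy) eqxx in neq_yw.
  have [->|neq_vw] := eqVneq v w.
    by apply: leq_trans (subset_leq_card lgw) _; rewrite cards1.
  apply: leq_trans (deg v); apply/subset_leq_card/subsetP=> y; rewrite !inE.
  have [->|neq_yw] := eqVneq y w; first by rewrite gw.
  have [->|neq_yb] := eqVneq y b; last by rewrite gE.
  by rewrite gb => /eqP[eq_wv]; rewrite eq_wv eqxx in neq_vw.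
- apply/subsetP=> y; apply: contraTT => /uncoveredP[gy ly].
  have neq_yw : y != w by apply/eqP=> eq_yw; apply: (ly b); rewrite gb eq_yw.
  have neq_yb : y != b by apply/eqP=> eq_yb; rewrite eq_yb gb in gy.
  apply/uncoveredP; split=> [|z fz]; first by rewrite -gE.
  apply: (ly z); rewrite gE //; apply/eqP=> eq_z; rewrite eq_z in fz.
    by move: fz neq_yb; rewrite fw => -[->]; rewrite eqxx.
  by rewrite fb in fz.
- by rewrite (leq_trans (subset_leq_card lgw)) ?cards1.
Qed.

(** If [w] is not a leaf, [x] is attached to it. If [w] is one of two leaves, it is detached and
    joined to [x]. If [w] is the only leaf of its star, the edge is flipped first. *)
Lemma augment f x w :
  star_packing f -> x \notin covered f -> e x w -> #|leaves f w| != 2 ->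
  exists2 g, star_packing g & #|covered f| < #|covered g|.
Proof.
move=> packf unx exw deg_w.
have [edges deg] := star_packingP _ packf.
have neq_wx : w != x by apply: contraTneq exw => ->; rewrite e_irr.
suff [g packg sub] : exists2 g, star_packing g & x |: covered f \subset covered g.
  exists g => //; apply: leq_trans (subset_leq_card sub).
  by rewrite cardsU1 unx.
have [fx lx] := uncoveredP _ _ unx.
case fw: (f w) => [b|]; last first.
  have [|packg sub] := add_leaf packf unx exw fw; last by exists (update f x (Some w)).
  by rewrite ltn_neqAle deg_w deg.
have [deg_b|deg_b] := ltnP 1 #|leaves f b|.
  have [packg sub lw] := free_leaf packf fw deg_b.
  set g := update f w None in packg sub lw.
  have gw : g w = None by rewrite update_same.
  have ung : x \notin covered g.
    apply/uncoveredP; split=> [|y]; first by rewrite ffunE fx if_same.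
    by rewrite ffunE; case: ifP.
  have [|packh subh] := add_leaf packg ung exw gw; first by rewrite lw cards0.
  exists (update g x (Some w)) => //.
  rewrite subUset sub1set; apply/andP; split.
    by apply: (subsetP subh); rewrite setU11.
  apply: subset_trans sub _; rewrite subUset sub1set; apply/andP; split.
    by apply: covered_center (x) _ _; rewrite update_same.
  exact: subset_trans (subsetU1 _ _) subh.
have [g [packg sub gw deg_g]] := flip_star packf fw deg_b.
(* The flip is only known not to shrink the covered set, so the case where [g] already covers [x] is
   treated apart. *)
have [gx|ungx] := boolP (x \in covered g).
  by exists g => //; rewrite subUset sub1set gx.
have [//|packh subh] := add_leaf packg ungx exw gw.
exists (update g x (Some w)) => //; apply: subset_trans subh; exact: setUS.
Qed.

(** * Augmenting along alternating paths *)

(** One step stands for two edges: from [x] to a center [w], then from [w] to its leaf [y]. *)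
Definition alternating f : rel V :=
  fun x y => if f y is Some w then e x w else false.

Lemma path_eq_target (r r' : rel V) x p :
  (forall a b, b \in p -> r a b = r' a b) -> path r x p = path r' x p.
Proof.
elim: p x => //= y p IH x eqr.
rewrite eqr ?mem_head // IH // => a b bp; apply: eqr.
by rewrite inE bp orbT.
Qed.

(* Moving the leaf [y] out of its star and [x] into it. *)
Lemma shift_leaf f x y w :
  star_packing f -> x \notin covered f -> f y = Some w -> e x w ->
  let g := update (update f x (Some w)) y None in
  [/\ star_packing g, y \notin covered g, #|covered g| = #|covered f|
    & forall v, #|leaves g v| = #|leaves f v|].
Proof.
move=> /star_packingP[edges deg] unx fy exw g.
have [fx lx] := uncoveredP _ _ unx.
have [eyw fw] := edges _ _ fy.
have neq_xy : x != y by apply/eqP=> eq_xy; rewrite -eq_xy fx in fy.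
have neq_wx : w != x by apply: contraTneq exw => ->; rewrite e_irr.
have neq_wy : w != y by apply: contraTneq eyw => ->; rewrite e_irr.
have gx : g x = Some w by rewrite update_other // update_same.
have gy : g y = None by rewrite update_same.
have gE z : z != x -> z != y -> g z = f z.
  by move=> neq_zx neq_zy; rewrite !update_other.
have ly z : f z <> Some y by move=> /edges[_]; rewrite fy.
have lgw : leaves g w = x |: leaves f w :\ y.
  apply/setP=> z; rewrite !inE.
  have [->|neq_zx] := eqVneq z x; first by rewrite gx eqxx.
  by have [->|neq_zy] := eqVneq z y; rewrite ?gy ?gE.
have lgE v : v != w -> leaves g v = leaves f v.
  move=> neq_vw; apply/setP=> z; rewrite !inE.
  have [->|neq_zx] := eqVneq z x.
    by rewrite gx fx; apply/eqP=> -[eq_wv]; rewrite eq_wv eqxx in neq_vw.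
  have [->|neq_zy] := eqVneq z y; last by rewrite gE.
  by rewrite gy fy; apply/esym/eqP=> -[eq_wv]; rewrite eq_wv eqxx in neq_vw.
have deg_g v : #|leaves g v| = #|leaves f v|.
  have [->|neq_vw] := eqVneq v w; last by rewrite lgE.
  by rewrite lgw cardsU1 (cardsD1 y (leaves f w)) !inE fx fy eqxx andbF.
have covg : covered g = x |: covered f :\ y.
  apply/setP=> z; rewrite !inE.
  have eq_l : (leaves g z != set0) = (leaves f z != set0).
    by rewrite -!card_gt0 deg_g.
  rewrite eq_l; have [->|neq_zx] := eqVneq z x; first by rewrite gx.
  have [->|neq_zy] := eqVneq z y; last by rewrite gE.
  rewrite gy /=; apply/set0Pn=> -[u]; rewrite inE => /eqP; exact: ly.
split=> //.
- apply/star_packingP; split=> [z v|v]; last by rewrite deg_g.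
  have [->|neq_zx] := eqVneq z x; first by rewrite gx => -[<-]; rewrite gE.
  have [->|neq_zy] := eqVneq z y; first by rewrite gy.
  rewrite gE // => /[dup] fz /edges[ezv fv]; split=> //.
  have [->//|neq_vy] := eqVneq v y; rewrite gE //.
  by apply/eqP=> eq_vx; apply: (lx z); rewrite fz eq_vx.
- by rewrite covg !inE eqxx eq_sym (negPf neq_xy).
- rewrite covg cardsU1 (cardsD1 y (covered f)) (covered_leaf fy) 2!inE.
  by rewrite (negPf unx) andbF.
Qed.

(** Shifting a leaf along the first step moves the uncovered vertex from [x] to [y] and preserves
    all leaf counts. Repeating this brings it to the end of the path, where [augment] applies. *)
Lemma augment_along_path p f x w :
  star_packing f -> x \notin covered f ->
  path (alternating f) x p -> uniq (x :: p) ->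
  e (last x p) w -> #|leaves f w| != 2 ->
  exists2 g, star_packing g & #|covered f| < #|covered g|.
Proof.
elim: p f x => [|y p IH] f x packf unx /=.
  by move=> _ _; apply: augment.
rewrite {1}/alternating; case fy: (f y) => [v|//] /andP[exv altp].
case/andP; rewrite inE negb_or => /andP[neq_xy xNp] /andP[yNp uniqp] elw deg_w.
have [packg ung cardg degg] := shift_leaf packf unx fy exv.
rewrite -cardg; apply: (IH _ y packg ung) => //; last 2 first.
- by rewrite /= yNp.
- by rewrite degg.
(* The shifted packing differs from [f] only at [x] and [y], which do not occur in [p], so the rest
   of the path is still alternating. *)
rewrite -(@path_eq_target (alternating f)) // => a b bp; rewrite /alternating.
rewrite !update_other //; first by apply: contraNneq xNp => <-.
by apply: contraNneq yNp => <-.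
Qed.

(** * The min-max theorem and its path form *)

Lemma sum_card_leaves f (S : {set V}) :
  \sum_(w in S) #|leaves f w|
  = #|[set y | if f y is Some w then w \in S else false]|.
Proof.
transitivity (\sum_(w in S) \sum_y (f y == Some w : nat)).
  by apply: eq_bigr => w _; rewrite -sum1dep_card big_mkcond.
rewrite exchange_big -sum1dep_card [RHS]big_mkcond; apply: eq_bigr => y _.
case fy: (f y) => [v|] /=; last by rewrite big1.
have [vS|vNS] := boolP (v \in S).
  rewrite (bigD1 v) //= eqxx big1 // => w /andP[_ neq_wv].
  by rewrite (inj_eq Some_inj) eq_sym (negPf neq_wv).
rewrite big1 // => w wS; rewrite (inj_eq Some_inj).
by case: eqP => // eq_vw; rewrite eq_vw wS in vNS.
Qed.

Definition neighbors (X : {set V}) : {set V} :=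
  [set w | [exists x in X, e x w]].

(** Take [f] covering the most vertices and [X] the set reached by alternating paths from uncovered
    vertices. By maximality each neighbor of [X] is a center with two leaves, and these lie in [X].
    Together with the uncovered vertices they give the bound. *)
Lemma star_packing_minmax :
  exists2 f, star_packing f &
  exists2 X : {set V}, [disjoint X & neighbors X] &
    #|V| + 2 * #|neighbors X| <= #|covered f| + #|X|.
Proof.
have pack0 : star_packing [ffun=> None].
  apply/star_packingP; split=> [x w|w]; first by rewrite ffunE.
  rewrite (_ : leaves _ _ = set0) ?cards0 //.
  by apply/setP=> x; rewrite !inE ffunE.
case: (arg_maxnP (fun f => #|covered f|) pack0) => f packf fmax.
have [edges deg] := star_packingP _ packf.
pose X := [set y | [exists x, (x \notin covered f) && connect (alternating f) x y]].
have uncX : ~: covered f \subset X.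
  apply/subsetP=> x; rewrite !in_setC => unx; rewrite inE; apply/existsP; exists x.
  by rewrite unx connect0.
have full y w : y \in X -> e y w -> #|leaves f w| = 2.
  rewrite inE => /existsP[x /andP[unx /connectP[p altp ->]]] eyw.
  apply/eqP; apply/negPn/negP=> deg_w.
  (* Augmentation needs a path without repeated vertices. *)
  case/shortenP: altp eyw => q altq uniqq _ eqw.
  have [g packg] := augment_along_path packf unx altq uniqq eqw deg_w.
  by rewrite ltnNge; have /= -> := fmax g packg.
have closed y w z : y \in X -> e y w -> f z = Some w -> z \in X.
  rewrite inE => /existsP[x /andP[unx conn]] eyw fz.
  rewrite inE; apply/existsP; exists x; rewrite unx /=.
  by apply: connect_trans conn (connect1 _); rewrite /alternating fz.
exists f => //; exists X.
  rewrite -setI_eq0; apply/eqP/setP=> w; rewrite !inE.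
  apply/negP=> /andP[/existsP[x /andP[unx /connectP[p altp eq_w]]]].
  case/existsP=> y /andP[yX eyw].
  have : 0 < #|leaves f w| by rewrite (full y).
  rewrite card_gt0 => /set0Pn[z]; rewrite inE => /eqP fz.
  have [_ fw] := edges _ _ fz.
  (* A vertex of [X] is uncovered if its path is empty and a leaf otherwise; the center [w] is
     neither. *)
  case: (lastP p) altp eq_w => [_ /= eq_w|q v].
    by have /uncoveredP[_ lx] := unx; apply: (lx z); rewrite -eq_w.
  rewrite rcons_path last_rcons /alternating => /andP[_ alt] eq_w.
  by rewrite -eq_w fw in alt.
set S := neighbors X.
have <- : \sum_(w in S) #|leaves f w| = 2 * #|S|.
  rewrite mulnC -sum_nat_const; apply: eq_bigr => w.
  by rewrite inE => /existsP[y /andP[yX /(full _ _ yX)]].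
rewrite sum_card_leaves -(cardsC (covered f)) -addnA leq_add2l.
set L := [set y | _].
have disj : [disjoint ~: covered f & L].
  rewrite -setI_eq0; apply/eqP/setP=> y; rewrite !inE.
  by case: (f y) => [v|] //=; rewrite andbF.
move: (leq_card_setU (~: covered f) L).2; rewrite disj => /eqP <-.
apply: subset_leq_card; rewrite subUset uncX /=.
apply/subsetP=> y; rewrite inE; case fy: (f y) => [v|//].
by rewrite inE => /existsP[x /andP[xX /closed]]; apply.
Qed.

(** The center comes second, hence between the leaves when there are two. The empty list is a
    default for vertices without leaves. *)
Definition star_path f w : seq V :=
  if enum (leaves f w) is x :: s then x :: w :: s else [::].

Lemma star_packing_paths f : star_packing f ->
  exists M : seq (seq V),
    [/\ uniq (flatten M), all (fun p => 2 <= size p) M, all (sorted e) M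
      & flatten M =i covered f].
Proof.
move=> /star_packingP[edges deg].
pose C := [set w | leaves f w != set0].
pose M := [seq star_path f w | w <- enum C].
have centerP w : w \in C -> exists x s,
    [/\ enum (leaves f w) = x :: s, star_path f w = x :: w :: s & size s <= 1].
  rewrite inE -card_gt0 /star_path => lw; have := deg w; move: lw.
  by rewrite cardE; case: (enum _) => // x s _ le_s; exists x, s.
have leafE w y : (f y == Some w) = (y \in enum (leaves f w)).
  by rewrite mem_enum inE.
have memM : flatten M =i covered f.
  move=> y; apply/flatten_mapP/idP => [[w]|].
    rewrite mem_enum => /centerP[x [s [enumE -> _]]].
    have lx : f x = Some w by apply/eqP; rewrite leafE enumE mem_head.
    rewrite !inE => /or3P[/eqP->|/eqP->|ys].
    - by rewrite lx.
    - by rewrite orbC; have := covered_center lx; rewrite inE orbC.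
    - have /eqP-> : f y == Some w by rewrite leafE enumE inE ys orbT.
      by [].
  rewrite inE => /orP[|ly].
    case fy: (f y) => [w|//] _.
    have wC : w \in C by rewrite inE; apply/set0Pn; exists y; rewrite inE fy.
    exists w; first by rewrite mem_enum.
    have [x [s [enumE -> _]]] := centerP _ wC.
    move/eqP: fy; rewrite leafE enumE !inE => /orP[->//|->].
    by rewrite !orbT.
  have yC : y \in C by rewrite inE.
  exists y; first by rewrite mem_enum.
  by have [x [s [_ -> _]]] := centerP _ yC; rewrite !inE eqxx orbT.
exists M; split=> //.
(* Uniqueness by counting: the total length, one plus the number of leaves summed over the centers,
   equals the number of covered vertices. *)
- apply/card_uniqP; rewrite (eq_card memM) size_flatten sumnE !big_map.
  rewrite big_enum /=.
  transitivity (\sum_(w in C) (1 + #|leaves f w|)); last first.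
    apply: eq_bigr => w /centerP[x [s [enumE -> _]]].
    by rewrite cardE enumE.
  rewrite big_split /= sum1_card sum_card_leaves.
  set L := [set y | _].
  have disj : [disjoint C & L].
    rewrite -setI_eq0; apply/eqP/setP=> y; rewrite !inE.
    apply/negP=> /andP[/set0Pn[x]]; rewrite inE => /eqP /edges[_ ->] //.
  move: (leq_card_setU C L).2; rewrite disj => /eqP <-.
  apply: eq_card => y; rewrite !inE orbC; congr (_ || _).
  case fy: (f y) => [w|] //; rewrite inE; apply/esym/set0Pn.
  by exists y; rewrite inE fy.
- by apply/allP=> p /mapP[w]; rewrite mem_enum => /centerP[x [s [_ -> _]]] ->.
- apply/allP=> p /mapP[w]; rewrite mem_enum => /centerP[x [s [enumE -> le_s]]] ->.
  have edge y : y \in x :: s -> e y w.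
    by rewrite -enumE -leafE => /eqP /edges[].
  case: s le_s edge {enumE} => [|y [|//]] _ edge /=.
    by rewrite edge ?mem_head.
  by rewrite edge ?mem_head // e_sym edge // !inE eqxx orbT.
Qed.

Lemma path_matching_minmax :
  exists M : seq (seq V),
    [/\ uniq (flatten M), all (fun p => 2 <= size p) M, all (sorted e) M
      & exists2 X : {set V}, [disjoint X & neighbors X] &
        #|V| + 2 * #|neighbors X| <= #|[set x in flatten M]| + #|X|].
Proof.
have [f packf [X disjX cardX]] := star_packing_minmax.
have [M [uniqM sizeM sortM memM]] := star_packing_paths packf.
exists M; split=> //; exists X => //.
by rewrite (_ : [set x in flatten M] = covered f) //; apply/setP=> x; rewrite inE.
Qed.

End StarPacking.

(** * Color classes and the conclusion *)

Lemma edge_colored_sym n r (c : edge n -> 'I_r) a : symmetric (edge_colored c a).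
Proof.
by move=> x y; apply: eq_existsb => d; rewrite (setUC [set x] [set y]).
Qed.

Lemma edge_colored_irr n r (c : edge n -> 'I_r) a :
  irreflexive (edge_colored c a).
Proof.
move=> x; apply/existsP=> -[[d card_d] /andP[/eqP /= eq_d _]].
by rewrite eq_d setUid cards1 in card_d.
Qed.

Lemma edge_colored_total n r (c : edge n -> 'I_r) x y :
  x != y -> exists a, edge_colored c a x y.
Proof.
move=> neq_xy; have card_xy : #|[set x; y]| == 2 by rewrite cards2 neq_xy.
pose d : edge n := exist _ [set x; y] card_xy.
by exists (c d); apply/existsP; exists d; rewrite !eqxx.
Qed.

Theorem corollary1p4 (r n : nat) (hr : 2 <= r) (hn : 0 < n)
    (c : edge n -> 'I_r) :
  exists M : seq (seq 'I_n),
    [/\ path_matching M, monochromatic c M & 3 * (n %/ (r + 2)) <= pm_order M].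
Proof.
have := leq_trunc_div n (r + 2); move: (n %/ (r + 2)) => k le_kn.
pose e a := edge_colored c a.
pose good (X : 'I_r -> {set 'I_n}) :=
  forall a, [disjoint X a & neighbors (e a) (X a)]
            /\ n + 2 * #|neighbors (e a) (X a)| < 3 * k + #|X a|.
(* If some color admits no such set, the min-max theorem in that color yields the matching;
   otherwise one set is chosen for each color. *)
have [//|[X goodX]] : (exists M : seq (seq 'I_n),
    [/\ path_matching M, monochromatic c M & 3 * k <= pm_order M])
    \/ exists X, good X.
  pose short a (X : {set 'I_n}) := [disjoint X & neighbors (e a) X]
    && (n + 2 * #|neighbors (e a) X| < 3 * k + #|X|).
  have [/forallP allshort|] := boolP [forall a, [exists X, short a X]].
    right; exists (fun a => xchoose (existsP (allshort a))) => a.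
    exact/andP/(xchooseP (existsP (allshort a))).
  rewrite negb_forall => /existsP[a]; rewrite negb_exists => /forallP noX.
  left; have [M [uniqM sizeM sortM [X disjX]]] :=
    path_matching_minmax (@edge_colored_sym _ _ c a) (@edge_colored_irr _ _ c a).
  rewrite card_ord => cardX; exists M; split; first by rewrite /path_matching uniqM.
    by exists a.
  move: (noX X); rewrite /short disjX /= -leqNgt => lower.
  by have := leq_trans lower cardX; rewrite leq_add2r.
exfalso.
pose N a : {set 'I_n} := neighbors (e a) (X a).
pose B a := ~: (X a :|: N a).
pose t a := k - #|N a|.
have cardB a : #|B a| + #|X a| + #|N a| = n.
  have [disjX _] := goodX a.
  move: (leq_card_setU (X a) (N a)).2; rewrite disjX => /eqP eqU.
  by rewrite -addnA addnC -eqU cardsC card_ord.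
(* Substituting [n] from [cardB] gives [#|B a| + 3 * #|N a| < 3 * k]. In particular [#|N a| < k], so
   the subtraction in [t] is not truncated. *)
have smallB a : #|B a| < 3 * t a.
  have := cardB a.
  have [_ small] : _ /\ n + 2 * #|N a| < 3 * k + #|X a| := goodX a.
  by rewrite /t; lia.
have sumN : \sum_a #|N a| + \sum_a t a = r * k.
  rewrite -big_split /= -[r in RHS]card_ord -sum_nat_const.
  apply: eq_bigr => a _; apply/subnKC/ltnW.
  by have := leq_ltn_trans (leq0n _) (smallB a); rewrite muln_gt0 subn_gt0.
have r_gt0 : 0 < r by apply: leq_trans hr.
have [a0 _ tmax] := @arg_maxnP _ (Ordinal r_gt0) xpredT t isT.
pose W := ~: \bigcup_a N a.
have cardW : n <= #|W| + \sum_a #|N a|.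
  rewrite -[X in X <= _]card_ord -(cardsC W) leq_add2l setCK.
  exact: card_bigcup_leq.
(* For an edge of color [a], an end in [X a] would put the other end in [N a], which [W] avoids. *)
have coverB : {in W &, forall u v, u != v -> exists2 a, u \in B a & v \in B a}.
  move=> u v; rewrite !inE => /bigcupP uNN /bigcupP vNN neq_uv.
  have [a euv] := edge_colored_total c neq_uv.
  exists a; rewrite !inE negb_or; apply/andP; split; apply/negP=> h.
  - by apply: vNN; exists a => //; rewrite inE; apply/existsP; exists u; rewrite h.
  - by apply: uNN; exists a => //; rewrite inE.
  - apply: uNN; exists a => //; rewrite inE; apply/existsP; exists v.
    by rewrite h /e edge_colored_sym.
  - by apply: vNN; exists a => //; rewrite inE.
(* The contradiction: [cardW], [sumN] and [(r + 2) * k <= n] give [#|W|] at least [2 * k] plus the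
   sum of the [t a], and [t a0 <= k]. *)
have := clique_cover_card (fun a => tmax a isT) smallB coverB.
have : t a0 <= k by exact: leq_subr.
lia.
Qed.
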